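(* A graph $G$ is a WTD(2) graph with $\mathrm{diam}(G)=3$ if and only if $G\in W_2$.
   Context: Graphs are finite, simple and nonempty (except where stated otherwise). A total dominating set (TDS) of a graph $G$ with no isolated vertices is a set $S\subseteq V(G)$ such that every vertex of $G$ is adjacent to at least one element of $S$; it is minimal if it contains no other TDS. $\gamma_t(G)$ is the minimum size of a TDS. $G$ is well-totally-dominated (WTD) if it has no isolated vertices and all its minimal TDSs have the same size. A WTD(2) graph is a WTD graph with $\gamma_t(G)=2$. The diameter $\mathrm{diam}(G)$ is the maximum length of a shortest path between any pair of vertices of $G$. $N(v)$ is the open neighborhood of $v$. A vertex cover of a graph $H$ is a set of vertices containing an endpoint of every edge of $H$; $MVC(H)$ is the set of all (inclusion-)minimal vertex covers of $H$. $W_2$ is the set of graphs (up to isomorphism) obtained as follows. Step 1: Choose a bipartite graph $H$ with no isolated vertices. Step 2: For every $S\in MVC(H)$, choose a new vertex $v_S$ (distinct for distinct $S$) and draw edges from $v_S$ to every vertex in $S$. Step 3: For each edge $uv$ in $H$ and every $w\in V(H)\setminus\{u,v\}$, add the edges $wu$ and/or $wv$ if needed to make sure $w$ is adjacent to at least one of $u$ and $v$ (one is free to add one or both of these edges, so the edges added between vertices of $V(H)$ may be any set of edges such that, in the resulting graph, every $w\in V(H)\setminus\{u,v\}$ is adjacent to at least one of $u,v$ for every edge $uv$ of $H$). Step 4: Choose a new graph $H'$ (which might be the empty graph) disjoint from the current graph. Then for each edge $uv$ in $H$ and every $w\in V(H')$, draw at least one of the edges $wu$ and $wv$. No other edges are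 added; in particular $N(v_S)=S$ in the final graph. *)

(* Defs.v *)
From mathcomp Require Import all_boot.

Set Implicit Arguments.
Unset Strict Implicit.
Unset Printing Implicit Defensive.

(* Finite simple graphs; the graph with no vertices is not excluded here, so
   that nonemptiness is stated wherever it is required. *)
Record sgraph := SGraph {
  vertex :> finType;
  adj : rel vertex;
  adj_sym : symmetric adj;
  adj_irrefl : irreflexive adj
}.

Definition isolated_free (G : sgraph) : Prop :=
  forall v : G, exists u : G, adj v u.

Definition bipartite (G : sgraph) : Prop :=
  exists c : G -> bool, forall u v : G, adj u v -> c u != c v.

Definition isomorphic (G K : sgraph) : Prop :=
  exists f : G -> K, bijective f /\ forall x y : G, adj (f x) (f y) = adj x y.

Definition total_dominating (G : sgraph) (S : {set G}) : bool :=
  [forall v : G, [exists u in S, adj v u]].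

Definition minimal_tds (G : sgraph) (S : {set G}) : bool :=
  minset (@total_dominating G) S.

(* Meaningful when G has no isolated vertex: the whole vertex set, used as the
   starting point of the minimisation, is then total dominating. *)
Definition gamma_t (G : sgraph) : nat :=
  #|[arg min_(S < [set: G] | total_dominating S) #|S|]|.

Definition wtd (G : sgraph) : Prop :=
  isolated_free G /\
  (forall S T : {set G}, minimal_tds S -> minimal_tds T -> #|S| = #|T|).

Definition wtd2 (G : sgraph) : Prop := wtd G /\ gamma_t G = 2.

(* x :: p lists the k.+1 distinct vertices of a path with k edges. *)
Definition has_path (G : sgraph) (k : nat) (x y : G) : bool :=
  [exists p : k.-tuple G,
     [&& path (@adj G) x p, uniq (x :: p) & last x p == y]].

(* A path has fewer than #|G| edges, so searching below #|G| finds the length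
   of a shortest path, provided that y can be reached from x. *)
Definition dist (G : sgraph) (x y : G) : nat :=
  find (fun k => has_path k x y) (iota 0 #|G|).

Definition connected (G : sgraph) : bool :=
  [forall x : G, forall y : G, connect (@adj G) x y].

(* None stands for the infinite diameter of a disconnected graph. *)
Definition diam (G : sgraph) : option nat :=
  if connected G then Some (\max_(x : G) \max_(y : G) dist x y) else None.

Definition vertex_cover (H : sgraph) (S : {set H}) : bool :=
  [forall u : H, forall v : H, adj u v ==> (u \in S) || (v \in S)].

Definition MVC (H : sgraph) : {set {set H}} :=
  [set S | minset (@vertex_cover H) S].

Section W2Construction.

(* A is the set of edges added inside V(H): A relates the endpoints of an added
   edge in at least one order, and its diagonal is ignored. B w u says that
   w in V(H') is joined to u in V(H). *)
Variables (H : sgraph) (A : rel H) (H' : sgraph) (B : H' -> H -> bool).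

Definition augmented_adj : rel H :=
  fun u v => adj u v || (u != v) && (A u v || A v u).

(* The vertices v_S are indexed by the elements S of MVC H. *)
Definition w2_vertex : finType := (H + {S : {set H} | S \in MVC H} + H')%type.

Definition w2_adj : rel w2_vertex := fun x y =>
  match x, y with
  | inl (inl u), inl (inl v) => augmented_adj u v
  | inl (inl u), inl (inr C) => u \in val C
  | inl (inr C), inl (inl u) => u \in val C
  | inl (inl u), inr w => B w u
  | inr w, inl (inl u) => B w u
  | inr w, inr z => adj w z
  | _, _ => false
  end.

Lemma w2_adj_sym : symmetric w2_adj.
Proof.
move=> [[u|C]|w] [[v|D]|z] //=; last exact: adj_sym.
by rewrite /augmented_adj adj_sym eq_sym [A u v || _]orbC.
Qed.

Lemma w2_adj_irrefl : irreflexive w2_adj.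
Proof.
move=> [[u|C]|w] //=; last exact: adj_irrefl.
by rewrite /augmented_adj adj_irrefl eqxx.
Qed.

Definition w2_graph : sgraph := SGraph w2_adj_sym w2_adj_irrefl.

Definition w2_step3 : Prop :=
  forall u v w : H, adj u v -> w != u -> w != v ->
    augmented_adj w u || augmented_adj w v.

Definition w2_step4 : Prop :=
  forall (u v : H) (w : H'), adj u v -> B w u || B w v.

End W2Construction.

Definition W2 (G : sgraph) : Prop :=
  exists (H : sgraph) (A : rel H) (H' : sgraph) (B : H' -> H -> bool),
    [/\ 0 < #|H|, bipartite H & isolated_free H] /\
    [/\ w2_step3 A, w2_step4 B & isomorphic G (w2_graph A B)].

(* Main.v *)
(** Everything rests on the dominating pairs, the pairs [u, v] such that [{u,
    v}] is total dominating. A graph with a vertex is WTD(2) iff it has no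
    isolated vertex and each of its TDSs contains a dominating pair, and then
    its diameter is at most 3. Given a graph in [W2], the edges of [H] are
    dominating pairs, and a TDS containing none of them would miss a minimal
    vertex cover [S], hence leave [v_S] undominated; the two sides of [H] are
    minimal vertex covers [X] and [Y], and [v_X], [v_Y] are at distance 3.
    Conversely, if [a] and [b] are at distance 3, let [H] consist of the
    dominating pairs: each has one end in [N(a)] and one in [N(b)], so [H] is
    bipartite. For a minimal vertex cover [S] of [H] the complement of [S]
    contains no dominating pair, so it is not a TDS and [N(v)] is included in
    [S] for some [v]; since [N(v)] meets every dominating pair, [N(v) = S].
    Such a [v] lies outside [H], for otherwise it would be adjacent to [a] or
    [b], which are not in [H]. *)
Require Import Defs.
From mathcomp Require Import all_boot.

Set Implicit Arguments.
Unset Strict Implicit.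
Unset Printing Implicit Defensive.

(** * Distance at least three *)

Section Distance.

Variable G : sgraph.
Implicit Types x y : G.

Lemma dist_le_path x p : path (@adj G) x p -> dist x (last x p) <= size p.
Proof.
case/shortenP=> q path_q uniq_q sub_qp.
have le_qp : size q <= size p.
  by apply: uniq_leq_size => //; case/andP: uniq_q.
apply: leq_trans le_qp.
have hasq : has_path (size q) x (last x q).
  by apply/existsP; exists (in_tuple q); rewrite path_q uniq_q eqxx.
rewrite /dist; case: (ltnP (size q) #|G|) => [lt_qG|le_Gq].
  rewrite leqNgt; apply/negP => /(before_find 0).
  by rewrite nth_iota // add0n hasq.
(* Even a failed search returns only the length [#|G|] of the list. *)
by apply: leq_trans le_Gq; rewrite -[leqRHS](size_iota 0) find_size.
Qed.

Lemma has_path_dist x y : connect (@adj G) x y -> has_path (dist x y) x y.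
Proof.
case/connectP=> p path_p ->; case/shortenP: path_p => q path_q uniq_q _.
have lt_qG : size q < #|G|.
  by have := max_card (mem (x :: q)); rewrite (card_uniqP uniq_q).
have hasP : has (fun k => has_path k x (last x q)) (iota 0 #|G|).
  apply/hasP; exists (size q); first by rewrite mem_iota.
  by apply/existsP; exists (in_tuple q); rewrite path_q uniq_q eqxx.
have := nth_find 0 hasP.
by rewrite nth_iota //; move: hasP; rewrite has_find size_iota.
Qed.

(** Excludes paths of length 0, 1 and 2 in turn; vertices in different components also qualify. *)
Definition far x y : Prop :=
  [/\ x != y, ~~ adj x y & forall z, adj x z -> ~~ adj y z].

(** Connectedness matters: for an unreachable pair [dist] takes the default value [#|G|], which may
    be 2. *)
Lemma far_dist x y : connect (@adj G) x y -> far x y -> 2 < dist x y.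
Proof.
move=> conn_xy [neq_xy nadj_xy disj_xy].
have /existsP[[p /= /eqP size_p]] := has_path_dist conn_xy.
case/and3P=> path_p _ /eqP last_p; rewrite -{}size_p.
case: p path_p last_p => [_ /eqP|z [|t [|s p]]] /=.
- by rewrite (negPf neq_xy).
- by rewrite andbT => adj_xz eq_zy; rewrite -eq_zy adj_xz in nadj_xy.
- rewrite andbT => /andP[adj_xz adj_zt] eq_ty.
  by have := disj_xy z adj_xz; rewrite -eq_ty adj_sym adj_zt.
by [].
Qed.

Lemma dist_far x y : 2 < dist x y -> far x y.
Proof.
move=> dist_xy; split.
- apply: contraL dist_xy => /eqP <-; rewrite -leqNgt.
  by apply: leq_trans (@dist_le_path x [::] _) _.
- apply: contraL dist_xy => adj_xy; rewrite -leqNgt.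
  by apply: leq_trans (@dist_le_path x [:: y] _) _; rewrite //= adj_xy.
move=> z adj_xz; apply: contraL dist_xy => adj_yz; rewrite -leqNgt.
apply: (@dist_le_path x [:: z; y]).
by rewrite /= adj_xz adj_sym adj_yz.
Qed.

End Distance.

(** * Dominating pairs, WTD(2) graphs and their diameter *)

Section DominatingPairs.

Variable G : sgraph.
Implicit Types (u v w x y : G) (S : {set G}).

Lemma total_dominatingP S :
  reflect (forall w, exists2 u, u \in S & adj w u) (total_dominating S).
Proof. exact: 'forall_exists_inP. Qed.

Definition dominating_pair u v := total_dominating [set u; v].

Lemma dominating_pairP u v :
  reflect (forall w, adj w u || adj w v) (dominating_pair u v).
Proof.
apply: (iffP (total_dominatingP _)) => dom_uv w.
  by have [t /set2P[] -> ->] := dom_uv w; rewrite ?orbT.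
by case/orP: (dom_uv w) => ?; [exists u | exists v]; rewrite ?set21 ?set22.
Qed.

Lemma dominating_pair_sym : symmetric dominating_pair.
Proof. by move=> u v; rewrite /dominating_pair setUC. Qed.

Lemma dominating_pair_adj u v : dominating_pair u v -> adj u v.
Proof. by move/dominating_pairP/(_ u); rewrite adj_irrefl. Qed.

Lemma dominating_pair_card u v : dominating_pair u v -> #|[set u; v]| = 2.
Proof.
move/dominating_pair_adj=> adj_uv; rewrite cards2.
by case: eqVneq adj_uv => // ->; rewrite adj_irrefl.
Qed.

Definition tds_contain_pairs : Prop :=
  forall S, total_dominating S ->
    exists u v, [set u; v] \subset S /\ dominating_pair u v.

Lemma total_dominatingT : isolated_free G -> total_dominating [set: G].
Proof.
by move=> G_if; apply/total_dominatingP => w; have [u] := G_if w; exists u.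
Qed.

(** A TDS of minimum size is minimal, so all minimal TDSs have size 2, and every TDS contains one of
    them. Conversely, a minimal TDS equals the dominating pair that it contains. *)
Lemma wtd2P : wtd2 G <-> isolated_free G /\ tds_contain_pairs.
Proof.
split=> [[[G_if G_wtd]]|[G_if pairs]].
  rewrite /gamma_t; case: arg_minnP => [|S0 S0_tds S0_min S0_2].
    exact: total_dominatingT.
  have S0_minimal : minimal_tds S0.
    apply/minsetP; split=> // T T_tds sTS0; apply/eqP.
    by rewrite eqEcard sTS0 S0_min.
  split=> // S S_tds; have [M M_min sMS] := minset_exists S_tds.
  have /eqP/cards2P[u [v [_ M_uv]]] : #|M| = 2 by rewrite -S0_2; apply: G_wtd.
  exists u, v; rewrite /dominating_pair -M_uv; split=> //.
  exact: minsetp M_min.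
have card_min S : minimal_tds S -> #|S| = 2.
  case/minsetP=> S_tds S_min; have [u [v [sub_S dom_uv]]] := pairs _ S_tds.
  by rewrite -(S_min _ dom_uv sub_S) dominating_pair_card.
split; first by split=> // S T /card_min -> /card_min ->.
rewrite /gamma_t; case: arg_minnP => [|S S_tds S_min].
  exact: total_dominatingT.
have [u [v [sub_S dom_uv]]] := pairs S S_tds.
apply/eqP; rewrite eqn_leq -(dominating_pair_card dom_uv) S_min //.
exact: subset_leq_card.
Qed.

(** Each of [x] and [y] is adjacent to [u] or [v], and [u] is adjacent to [v]. The walk may repeat
    vertices; [dist_le_path] allows this. *)
Lemma dominating_pair_path u v x y :
  dominating_pair u v ->
  exists p, [/\ path (@adj G) x p, last x p = y & size p <= 3].
Proof.
move=> dom_uv; have adj_uv := dominating_pair_adj dom_uv.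
have /orP[xu|xv] := dominating_pairP _ _ dom_uv x;
have /orP[yu|yv] := dominating_pairP _ _ dom_uv y.
- by exists [:: u; y]; rewrite /= xu adj_sym yu.
- by exists [:: u; v; y]; rewrite /= xu adj_uv adj_sym yv.
- by exists [:: v; u; y]; rewrite /= xv adj_sym adj_uv adj_sym yu.
- by exists [:: v; y]; rewrite /= xv adj_sym yv.
Qed.

Lemma dominating_pair_diam u v x y :
  dominating_pair u v -> far x y -> diam G = Some 3.
Proof.
move=> dom_uv far_xy.
have conn (s t : G) : connect (@adj G) s t.
  by have [p [? <- _]] := dominating_pair_path s t dom_uv; apply/connectP; exists p.
have dist_le (s t : G) : dist s t <= 3.
  have [p [path_p <-]] := dominating_pair_path s t dom_uv.
  exact/leq_trans/dist_le_path.
rewrite /diam ifT; last by apply/forallP=> s; apply/forallP.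
congr Some; apply/eqP; rewrite eqn_leq; apply/andP; split.
  by apply/bigmax_leqP => s _; apply/bigmax_leqP => t _.
apply: leq_trans (far_dist (conn x y) far_xy) _.
exact: leq_trans (leq_bigmax y) (leq_bigmax (F := fun s => \max_t dist s t) x).
Qed.

Lemma wtd2_diam3P : 0 < #|G| ->
  (wtd2 G /\ diam G = Some 3) <->
  [/\ isolated_free G, tds_contain_pairs & exists a b : G, far a b].
Proof.
move=> G_gt0; split=> [[/wtd2P[G_if pairs] diam3]|[G_if pairs [a [b far_ab]]]].
  split=> //; move: diam3; rewrite /diam; case: ifP => // _ [diam3].
  (* As [G] is nonempty, both nested maxima are attained. *)
  have [a max_a] := eq_bigmax (fun x : G => \max_(y : G) dist x y) G_gt0.
  have [b max_b] := eq_bigmax (fun y : G => dist a y) G_gt0.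
  by exists a, b; apply: dist_far; rewrite -max_b -max_a diam3.
split; first exact/wtd2P.
have [u [v [_ dom_uv]]] := pairs _ (total_dominatingT G_if).
exact: dominating_pair_diam dom_uv far_ab.
Qed.

End DominatingPairs.

(** * Invariance under isomorphism *)

Section Isomorphism.

Variables (G K : sgraph) (f : G -> K) (g : K -> G).
Hypotheses (fK : cancel f g) (gK : cancel g f).
Hypothesis adj_f : forall x y, adj (f x) (f y) = adj x y.

Lemma isolated_free_iso : isolated_free K -> isolated_free G.
Proof.
by move=> K_if x; have [y] := K_if (f x); exists (g y); rewrite -adj_f gK.
Qed.

Lemma tds_contain_pairs_iso : tds_contain_pairs K -> tds_contain_pairs G.
Proof.
move=> pairs S /total_dominatingP S_tds.
have fS_tds : total_dominating (f @: S).
  apply/total_dominatingP => w; have [u uS adj_wu] := S_tds (g w).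
  by exists (f u); rewrite ?imset_f // -(gK w) adj_f.
have [u' [v' [sub_S dom_uv]]] := pairs _ fS_tds.
have /imsetP[u uS u'E] := subsetP sub_S u' (set21 _ _).
have /imsetP[v vS v'E] := subsetP sub_S v' (set22 _ _).
exists u, v; split; first by rewrite subUset !sub1set uS.
apply/dominating_pairP => w; rewrite -!(adj_f w) -u'E -v'E.
exact: (dominating_pairP _ _ dom_uv).
Qed.

Lemma far_iso (a b : K) : far a b -> far (g a) (g b).
Proof.
case=> neq_ab nadj_ab disj; split.
- by rewrite (can_eq gK).
- by rewrite -adj_f !gK.
by move=> z; rewrite -!adj_f !gK; apply: disj.
Qed.

End Isomorphism.

(** Reverses the direction: the decomposition is built as a map into [G], while [isomorphic] asks
    for a map out of it. *)
Lemma isomorphic_from (G K : sgraph) (g : K -> G) :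
  injective g -> (forall x, exists y, g y = x) ->
  (forall x y, adj (g x) (g y) = adj x y) -> isomorphic G K.
Proof.
move=> inj_g surj_g adj_g; have [f fK] := fin_all_exists surj_g.
exists f; split; first by exists g => //; apply: inj_can_sym.
by move=> x y; rewrite -adj_g !fK.
Qed.

(** * Minimal vertex covers from a 2-colouring *)

Section VertexCovers.

Variable H : sgraph.

Lemma vertex_coverP (S : {set H}) :
  reflect (forall u v : H, adj u v -> (u \in S) || (v \in S)) (vertex_cover S).
Proof.
apply: (iffP forallP) => [cov u v|cov u].
  by move/forallP/(_ v)/implyP: (cov u).
by apply/forallP => v; apply/implyP; apply: cov.
Qed.

(** Every edge has exactly one end in the class, and every vertex of the class has an edge, which
    only that vertex covers. *)
Lemma color_class_MVC (c : H -> bool) (b : bool) :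
  isolated_free H -> (forall u v : H, adj u v -> c u != c v) ->
  [set u | c u == b] \in MVC H.
Proof.
move=> H_if col; rewrite inE; apply/minsetP; split.
  apply/vertex_coverP => u v /col; rewrite !inE.
  by case: (c u) (c v) b => [] [] [].
move=> S /vertex_coverP cov sub_S; apply/eqP; rewrite eqEsubset sub_S /=.
apply/subsetP => u; rewrite inE => /eqP cu; have [v adj_uv] := H_if u.
case/orP: (cov u v adj_uv) => // /(subsetP sub_S); rewrite inE => /eqP cv.
by have := col _ _ adj_uv; rewrite cu cv eqxx.
Qed.

End VertexCovers.

(** * Properties of the graphs in [W2] *)

Section W2Graph.

Variables (H : sgraph) (A : rel H) (H' : sgraph) (B : H' -> H -> bool).
Hypotheses (A_step3 : w2_step3 A) (B_step4 : w2_step4 B).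

Local Notation K := (w2_graph A B).

(** Other vertices of [H] are dominated by step 3, each [v_S] because [S] covers the edge, and [H']
    by step 4. *)
Lemma w2_dominating_pair (u v : H) :
  adj u v -> @dominating_pair K (inl (inl u)) (inl (inl v)).
Proof.
move=> adj_uv; apply/dominating_pairP => -[[w|C]|w] /=.
- have [->|neq_wu] := eqVneq w u; first by rewrite /augmented_adj adj_uv orbT.
  have [->|neq_wv] := eqVneq w v; last exact: A_step3.
  by rewrite /augmented_adj adj_sym adj_uv.
- have := valP C; rewrite inE => /minsetp/vertex_coverP; exact.
exact: B_step4.
Qed.

Lemma w2_tds_contain_pairs : tds_contain_pairs K.
Proof.
move=> D /total_dominatingP D_tds.
pose U := [set u : H | inl (inl u) \notin D].
(* If [U] is a cover, it contains a minimal one [S], and [v_S] has no neighbour in [D]; otherwise an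
   edge missed by [U] has both ends in [D]. *)
have [U_cov|] := boolP (vertex_cover U).
  have [S S_min sub_SU] := minset_exists U_cov.
  have S_MVC : S \in MVC H by rewrite inE.
  have [[[u|C]|w] uD] := D_tds (inl (inr (Sub S S_MVC))) => //=.
  by move/(subsetP sub_SU); rewrite inE uD.
case/forallPn=> u /forallPn[v]; rewrite negb_imply negb_or !inE !negbK.
case/and3P=> adj_uv uD vD; exists (inl (inl u)), (inl (inl v)).
by rewrite subUset !sub1set uD vD; split=> //; apply: w2_dominating_pair.
Qed.

Lemma w2_isolated_free : 0 < #|H| -> isolated_free H -> isolated_free K.
Proof.
case/card_gt0P=> u _ H_if w; have [v adj_uv] := H_if u.
by case/orP: (dominating_pairP _ _ (w2_dominating_pair adj_uv) w) => ?;
  [exists (inl (inl u)) | exists (inl (inl v))].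
Qed.

Lemma w2_far : 0 < #|H| -> isolated_free H -> bipartite H ->
  exists a b : K, far a b.
Proof.
case/card_gt0P=> u _ H_if [c col].
pose side b : {S : {set H} | S \in MVC H} :=
  exist (fun S : {set H} => S \in MVC H) _ (color_class_MVC b H_if col).
exists (inl (inr (side true))), (inl (inr (side false))); split=> //.
  apply/eqP => -[] /setP/(_ u); rewrite !inE.
  by case: (c u).
by case=> [[w|C]|w] //=; rewrite !inE => /eqP ->.
Qed.

End W2Graph.

(** * Decomposition of a WTD(2) graph of diameter 3 *)

Section Decomposition.

Variable G : sgraph.
Hypotheses (G_if : isolated_free G) (pairs : tds_contain_pairs G).
Variables a b : G.
Hypothesis far_ab : far a b.

Definition core_vertex := {x : G | [exists y, dominating_pair x y]}.

Definition core_adj : rel core_vertex :=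
  fun x y => dominating_pair (val x) (val y).

Lemma core_adj_sym : symmetric core_adj.
Proof. by move=> x y; apply: dominating_pair_sym. Qed.

Lemma core_adj_irrefl : irreflexive core_adj.
Proof.
by move=> x; apply/negP => /dominating_pair_adj; rewrite adj_irrefl.
Qed.

Definition core : sgraph := SGraph core_adj_sym core_adj_irrefl.

Lemma core_mem (x y : G) :
  dominating_pair x y -> exists x' : core, val x' = x.
Proof.
move=> dom_xy; have xP : [exists y, dominating_pair x y] by apply/existsP; exists y.
by exists (Sub x xP : core_vertex); rewrite SubK.
Qed.

Lemma core_isolated_free : isolated_free core.
Proof.
move=> x; have /existsP[y dom_xy] := valP x.
have [|y' y'E] := @core_mem y (val x); first by rewrite dominating_pair_sym.
by exists y'; rewrite /= /core_adj y'E.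
Qed.

Lemma core_gt0 : 0 < #|core|.
Proof.
have [u [v [_ dom_uv]]] := pairs (total_dominatingT G_if).
by have [u' _] := core_mem dom_uv; apply/card_gt0P; exists u'.
Qed.

(** The partner of [x] in a dominating pair cannot be adjacent to both [a] and [b], which have no
    common neighbour. *)
Lemma core_adj_far (x : core) : adj a (val x) || adj b (val x).
Proof.
have [_ _ disj] := far_ab.
have /existsP[y /dominating_pairP dom_xy] := valP x.
case/orP: (dom_xy a) => [->//|ay]; case/orP: (dom_xy b) => [->|by_].
  by rewrite orbT.
by rewrite (negPf (disj _ ay)) in by_.
Qed.

Lemma core_bipartite : bipartite core.
Proof.
(* Two ends of the same colour would both be adjacent to [a], leaving [b] undominated. *)
exists (fun x => adj a (val x)) => x y /dominating_pairP dom_xy.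
have [_ _ disj] := far_ab; apply/negP => /eqP adj_ax.
have := dom_xy a; rewrite adj_ax orbb => ay; rewrite ay in adj_ax.
by have := dom_xy b; rewrite (negPf (disj _ ay)) (negPf (disj _ adj_ax)).
Qed.

Lemma far_notin_core (x : core) : (val x != a) && (val x != b).
Proof.
have [_ nadj_ab _] := far_ab; apply/andP; split; apply/eqP => xE.
  by have := core_adj_far x; rewrite xE adj_irrefl adj_sym (negPf nadj_ab).
by have := core_adj_far x; rewrite xE adj_irrefl (negPf nadj_ab).
Qed.

Lemma MVC_neighborhood (S : {set core}) :
  S \in MVC core -> exists v : G, [set z | adj v z] = val @: S.
Proof.
rewrite inE => /minsetP[/vertex_coverP S_cov S_min].
(* The complement is taken in all of [G], so a vertex that it leaves undominated has all its
   neighbours in [S]. *)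
have : ~~ total_dominating (~: (val @: S)).
  apply/negP => /pairs[u [v [sub_S dom_uv]]].
  have [u' u'E] := core_mem dom_uv.
  have [|v' v'E] := @core_mem v u; first by rewrite dominating_pair_sym.
  move: sub_S; rewrite subUset !sub1set !inE -u'E -v'E.
  rewrite !(mem_imset _ _ val_inj) -negb_or => /negP; apply.
  by apply: S_cov; rewrite /= /core_adj u'E v'E.
case/forallPn=> v /exists_inPn v_dom; exists v.
have sub_NS : [set z | adj v z] \subset val @: S.
  apply/subsetP => z; rewrite inE => adj_vz; apply/negPn/negP => zS.
  by have := v_dom z; rewrite inE zS adj_vz => /(_ isT).
apply/eqP; rewrite eqEsubset sub_NS /=; apply/subsetP => _ /imsetP[x xS ->].
(* [T] is a vertex cover because each edge of [core] dominates [v]; being inside [S], it equals [S]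
   by minimality. *)
pose T : {set core} := [set x : core | adj v (val x)].
suff TE : T = S by rewrite -TE inE in xS; rewrite inE.
apply: S_min.
  by apply/vertex_coverP => y z /dominating_pairP/(_ v); rewrite !inE.
apply/subsetP => y; rewrite inE => adj_vy.
by rewrite -(mem_imset _ _ val_inj) (subsetP sub_NS) ?inE.
Qed.

Variable cover_vertex : {S : {set core} | S \in MVC core} -> G.
Hypothesis cover_vertexP :
  forall C, [set z | adj (cover_vertex C) z] = val @: val C.

Lemma cover_vertex_adj C (x : core) :
  adj (cover_vertex C) (val x) = (x \in val C).
Proof.
by have /setP/(_ (val x)) := cover_vertexP C; rewrite inE (mem_imset _ _ val_inj).
Qed.

Lemma cover_vertex_adj_core C z :
  adj (cover_vertex C) z -> exists2 x : core, x \in val C & z = val x.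
Proof.
by move=> adj_z; apply/imsetP; rewrite -cover_vertexP inE.
Qed.

Lemma cover_vertex_notin_core C (x : core) : cover_vertex C != val x.
Proof.
apply/eqP => CE.
by case/orP: (core_adj_far x); rewrite adj_sym -CE;
  case/cover_vertex_adj_core=> y _ yE; have := far_notin_core y;
  rewrite -yE eqxx ?andbF.
Qed.

Lemma cover_vertex_inj : injective cover_vertex.
Proof.
move=> C D eq_CD; apply/val_inj/setP => x.
by rewrite -!cover_vertex_adj eq_CD.
Qed.

(** Plays the role of [H']; unchosen vertices with the same neighbourhood as some [cover_vertex C]
    fall here too. *)
Definition rest_vertex :=
  {x : G | ~~ [exists y, dominating_pair x y] && (x \notin codom cover_vertex)}.

Definition rest_adj : rel rest_vertex := fun x y => adj (val x) (val y).

Lemma rest_adj_sym : symmetric rest_adj.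
Proof. by move=> x y; apply: adj_sym. Qed.

Lemma rest_adj_irrefl : irreflexive rest_adj.
Proof. by move=> x; apply: adj_irrefl. Qed.

Definition rest : sgraph := SGraph rest_adj_sym rest_adj_irrefl.

Lemma rest_notin_core (w : rest) (x : core) : val w != val x.
Proof.
by have /andP[+ _] := valP w; apply: contra => /eqP ->; apply: (valP x).
Qed.

Lemma rest_notin_cover (w : rest) C : val w != cover_vertex C.
Proof.
by have /andP[_] := valP w; apply: contra => /eqP ->; apply: codom_f.
Qed.

Definition core_edges : rel core := fun x y => adj (val x) (val y).
Definition rest_edges (w : rest) (x : core) := adj (val w) (val x).

(** Dominating pairs are adjacent in [G], so their edges are already among [core_edges]. *)
Lemma core_augmented (x y : core) :
  augmented_adj core_edges x y = adj (val x) (val y).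
Proof.
rewrite /augmented_adj /core_edges [adj (val y) _]adj_sym orbb.
have [->|_] := eqVneq x y; first by rewrite !adj_irrefl.
by apply/orb_idl/dominating_pair_adj.
Qed.

Definition w2_embed (x : w2_graph core_edges rest_edges) : G :=
  match x with
  | inl (inl u) => val u
  | inl (inr C) => cover_vertex C
  | inr w => val w
  end.

Lemma w2_embed_inj : injective w2_embed.
Proof.
move=> [[x|C]|w] [[y|D]|z] /= /eqP.
- by move/eqP/val_inj ->.
- by rewrite eq_sym (negPf (cover_vertex_notin_core _ _)).
- by rewrite eq_sym (negPf (rest_notin_core _ _)).
- by rewrite (negPf (cover_vertex_notin_core _ _)).
- by move/eqP/cover_vertex_inj ->.
- by rewrite eq_sym (negPf (rest_notin_cover _ _)).
- by rewrite (negPf (rest_notin_core _ _)).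
- by rewrite (negPf (rest_notin_cover _ _)).
- by move/eqP/val_inj ->.
Qed.

Lemma w2_embed_surj x : exists y, w2_embed y = x.
Proof.
have [x_core|x_core] := boolP [exists y, dominating_pair x y].
  by exists (inl (inl (Sub x x_core))).
have [/codomP[C ->]|x_cover] := boolP (x \in codom cover_vertex).
  by exists (inl (inr C)).
have xP : ~~ [exists y, dominating_pair x y] && (x \notin codom cover_vertex).
  by rewrite x_core.
by exists (inr (Sub x xP : rest_vertex)).
Qed.

Lemma w2_embed_adj x y : adj (w2_embed x) (w2_embed y) = adj x y.
Proof.
(* All neighbours of a cover vertex are in the core, which rules out edges to other cover vertices
   and to the rest. *)
have cover_nadj C z : (forall x : core, z != val x) -> ~~ adj (cover_vertex C) z.
  move=> z_core; apply/negP => /cover_vertex_adj_core[t _ /eqP].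
  by rewrite (negPf (z_core t)).
case: x y => [[x|C]|w] [[y|D]|z] //=.
- by rewrite core_augmented.
- by rewrite adj_sym cover_vertex_adj.
- exact: adj_sym.
- exact: cover_vertex_adj.
- by apply: negbTE; apply: cover_nadj => t; apply: cover_vertex_notin_core.
- by apply: negbTE; apply: cover_nadj => t; apply: rest_notin_core.
- by rewrite adj_sym; apply: negbTE; apply: cover_nadj => t; apply: rest_notin_core.
Qed.

Lemma W2_decomposition : W2 G.
Proof.
exists core, core_edges, rest, rest_edges; split; split.
- exact: core_gt0.
- exact: core_bipartite.
- exact: core_isolated_free.
(* Steps 3 and 4 both hold because an edge of [core] dominates every vertex of [G]. *)
- move=> u v w /dominating_pairP dom_uv _ _; rewrite !core_augmented.
  exact: dom_uv.
- by move=> u v w /dominating_pairP; apply.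
exact: isomorphic_from w2_embed_inj w2_embed_surj w2_embed_adj.
Qed.

End Decomposition.

Theorem corollary3p6 (G : sgraph) (G_nonempty : 0 < #|G|) :
  (wtd2 G /\ diam G = Some 3) <-> W2 G.
Proof.
split=> [/(wtd2_diam3P G_nonempty)[G_if pairs [a [b far_ab]]]|].
  have nbh (C : {S : {set core G} | S \in MVC (core G)}) :=
    MVC_neighborhood pairs (valP C).
  (* Finite choice of one vertex [v_S] for each minimal vertex cover [S]. *)
  have [cover_vertex cover_vertexP] := fin_all_exists nbh.
  exact: W2_decomposition G_if pairs _ _ far_ab _ cover_vertexP.
case=> H [A [H' [B [[H_gt0 H_bip H_if]]]]].
case=> A_step3 B_step4 [f [[g fK gK] adj_f]].
apply/(wtd2_diam3P G_nonempty); split.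
- exact: isolated_free_iso gK adj_f (w2_isolated_free A_step3 B_step4 H_gt0 H_if).
- exact: tds_contain_pairs_iso gK adj_f (w2_tds_contain_pairs A_step3 B_step4).
have [a [b far_ab]] := w2_far A B H_gt0 H_if H_bip.
by exists (g a), (g b); apply: far_iso gK adj_f _ _ far_ab.
Qed.
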